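(* Let $n\ge1$ and let $\mu,\nu\in\mathring{\mathcal{S}}^n$ be two probability measures with $\mathcal{H}(\mu,\nu)=R>0$. Let $\theta_0(\mu),\theta_0(\nu)\in\mathbb{R}^n$ be their natural parameters. Then $\theta_0(\mu)$ belongs to the boundary $\partial\mathcal{C}$ of an $n$-dimensional convex polytope $\mathcal{C}\subset\mathbb{R}^n$ centred at $\theta_0(\nu)$, with $2(2^n-1)$ vertices, located at the points $$v_{\mathcal{I}}^+=\theta_0(\nu)+R\sum_{i\in\mathcal{I}}e_i,\qquad v_{\mathcal{I}}^-=\theta_0(\nu)-R\sum_{i\in\mathcal{I}}e_i,$$ where $\{e_i\}_{i=1}^n$ are the standard basis vectors of $\mathbb{R}^n$ and $\mathcal{I}$ ranges over the nonempty subsets of $\{1,\dots,n\}$.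
   Context: $\mathcal{S}^n=\{x\in\mathbb{R}_+^{n+1}:\sum_{i=0}^nx^i=1\}$ is the probability simplex (coordinates indexed by $0,\dots,n$) and $\mathring{\mathcal{S}}^n$ its interior, consisting of the points with all coordinates strictly positive. The map $\theta_0:\mathring{\mathcal{S}}^n\to\mathbb{R}^n$ is $\theta_0^i(\mu)=\log(\mu^i/\mu^0)$ for $i=1,\dots,n$. For $\mu,\nu\in\mathring{\mathcal{S}}^n$ the Hilbert projective metric is $\mathcal{H}(\mu,\nu)=\log\frac{\max_i\mu^i/\nu^i}{\min_j\mu^j/\nu^j}$. *)

(* Defs.v *)
From HB Require Import structures.
From mathcomp Require Import all_boot all_order all_algebra.
From mathcomp Require Import all_classical all_reals all_analysis.

Set Implicit Arguments.
Unset Strict Implicit.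
Unset Printing Implicit Defensive.

Import Order.TTheory GRing.Theory Num.Theory.
Import numFieldNormedType.Exports.

Local Open Scope classical_set_scope.
Local Open Scope ring_scope.

Section Simplex.
Variables (R : realType) (n : nat).
Implicit Types mu nu : 'rV[R]_n.+1.

Definition simplex : set 'rV[R]_n.+1 :=
  [set x | (forall i, 0 <= x 0 i) /\ \sum_i x 0 i = 1].

(* The interior is the relative one: as a subset of R^(n+1) the simplex has
   empty topological interior. *)
Definition simplex_interior : set 'rV[R]_n.+1 :=
  [set x | simplex x /\ forall i, 0 < x 0 i].

(* The coordinate i in {1, ..., n} is represented by lift ord0 j, for the
   j : 'I_n with value i - 1. *)
Definition theta0 mu : 'rV[R]_n :=
  \row_j ln (mu 0 (lift ord0 j) / mu 0 ord0).

(* The default value of both big operators is one of the values ranged over, so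
   they are the plain maximum and minimum. *)
Definition hilbert mu nu : R :=
  ln (\big[Num.max/mu 0 ord0 / nu 0 ord0]_i (mu 0 i / nu 0 i) /
      \big[Num.min/mu 0 ord0 / nu 0 ord0]_i (mu 0 i / nu 0 i)).

End Simplex.

Section Polytope.
Variables (R : realType) (n : nat).
Local Notation V := 'rV[R]_n.
Implicit Types (A C S : set V) (c : V).

Definition convex_hull S : set V := smallest (@convex_set R V) S.

Definition convex_polytope C : Prop :=
  exists2 S : set V, finite_set S & C = convex_hull S.

Definition affine_set A : Prop :=
  forall x y (t : R), A x -> A y -> A (t *: x + (1 - t) *: y).

Definition affine_hull S : set V := smallest affine_set S.

(* C has dimension k when its affine hull is a translate of a k-dimensional
   linear subspace; the empty set has no dimension. *)
Definition has_dimension C (k : nat) : Prop :=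
  exists (p : V) (W : {vspace V}),
    \dim W = k /\ affine_hull C = [set p + w | w in [set` W]].

(* Central symmetry. *)
Definition centred_at C c : Prop :=
  forall h : V, C (c + h) <-> C (c - h).

(* The vertices of a polytope are its extreme points. *)
Definition vertices C : set V :=
  [set v | C v /\ forall x y (t : R), C x -> C y -> 0 < t -> t < 1 ->
    v = t *: x + (1 - t) *: y -> x = v /\ y = v].

Definition boundary A : set V := closure A `\` interior A.

Definition vplus c (r : R) (I : {set 'I_n}) : V :=
  c + r *: \sum_(i in I) delta_mx 0 i.

Definition vminus c (r : R) (I : {set 'I_n}) : V :=
  c - r *: \sum_(i in I) delta_mx 0 i.

End Polytope.

(* Main.v *)
(* Prepending a coordinate 0 to h = theta0 mu - theta0 nu turns H(mu, nu) into
   the oscillation max h - min h of the extended vector, so C is the ball of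
   radius r of the oscillation seminorm.  That ball is the image of the cube
   [0, r]^(n+1) under the affine map y |-> theta0 nu + (y_i - y_0)_i, hence the
   hull of the images of the vertices of the cube.  These images are the v_I^+
   (y_0 = 0) and the v_I^- (y_0 = r), together with the centre, the only one of
   them that is not extreme. *)
Require Import Defs.
From HB Require Import structures.
From mathcomp Require Import all_boot all_order all_algebra.
From mathcomp Require Import all_classical all_reals all_analysis.
From mathcomp Require Import ring lra.

Set Implicit Arguments.
Unset Strict Implicit.
Unset Printing Implicit Defensive.

Import Order.TTheory GRing.Theory Num.Theory.
Import numFieldNormedType.Exports.
Local Open Scope classical_set_scope.
Local Open Scope card_scope.
Local Open Scope ring_scope.

(** * Preliminaries on convexity and counting *)

Lemma convex_setE (R : realType) (M : lmodType R) (A : set M) :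
  convex_set (A : set (convex_lmodType M)) <->
  forall (x y : M) (t : R), 0 <= t -> t <= 1 -> A x -> A y ->
    A (t *: x + (1 - t) *: y).
Proof.
split=> [cA x y t t0 t1 Ax Ay|cA x y t xA yA].
  have := cA x y (Itv01 t0 t1); rewrite !inE; exact.
by move: xA yA; rewrite !inE => Ax Ay; apply: cA.
Qed.

Lemma convex_convex_hull (R : realType) (n : nat) (S : set 'rV[R]_n) :
  convex_set (convex_hull S : set (convex_lmodType 'rV[R]_n)).
Proof.
apply/convex_setE => x y t t0 t1 Sx Sy T [cT ST].
by move/convex_setE: (cT); apply => //; [exact: Sx | exact: Sy].
Qed.

(** Deleting an extreme point from the hull leaves a convex set. If the point were outside [S], this
    smaller set would still contain [S], against minimality. *)
Lemma vertices_convex_hull (R : realType) (n : nat) (S : set 'rV[R]_n) :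
  vertices (convex_hull S) `<=` S.
Proof.
move=> v [Sv ext_v]; apply: contrapT => nSv.
have : (convex_hull S `\ v) v; last by case=> _; apply.
apply: (Sv (convex_hull S `\ v)); split; last first.
  move=> x Sx; split; first exact: sub_gen_smallest.
  by move=> xv; apply: nSv; rewrite -xv.
apply/convex_setE => x y t t0 t1 [Sx xv] [Sy yv]; split.
  by move/convex_setE: (@convex_convex_hull R n S); apply.
move=> /esym/= e.
have [t_eq0|t_neq0] := eqVneq t 0.
  by apply: yv; rewrite /= e t_eq0 scale0r add0r subr0 scale1r.
have [t_eq1|t_neq1] := eqVneq t 1.
  by apply: xv; rewrite /= e t_eq1 subrr scale0r addr0 scale1r.
have [||/xv//] := ext_v x y t Sx Sy _ _ e.
  by rewrite lt_neqAle t0 eq_sym t_neq0.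
by rewrite lt_neqAle t1 t_neq1.
Qed.

Lemma card_eq_finpred (T : finType) (P : {pred T}) :
  [set x | x \in P] #= `I_#|P|.
Proof.
have -> : [set x | x \in P] = [set enum_val i | i in [set: 'I_#|P|]].
  apply/seteqP; split=> [x /= xP|_ [i _ <-]]; last exact: enum_valP.
  by exists (enum_rank_in xP x) => //; rewrite enum_rankK_in.
apply: (card_eq_trans (inj_card_eq _)); last by rewrite card_eq_sym card_II.
by move=> i j _ _ /enum_val_inj.
Qed.

(** The gaps [t * (m - x)] and [(1 - t) * (m - y)] are nonnegative and sum to 0. *)
Lemma conv_eq_ub (R : realFieldType) (x y m t : R) : 0 < t -> t < 1 ->
  x <= m -> y <= m -> t * x + (1 - t) * y = m -> x = m /\ y = m.
Proof.
move=> t0 t1 xm ym e; have t1' : 0 < 1 - t by rewrite subr_gt0.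
have x0 : 0 <= t * (m - x) by rewrite mulr_ge0 ?subr_ge0// ltW.
have y0 : 0 <= (1 - t) * (m - y) by rewrite mulr_ge0 ?subr_ge0// ltW.
have {}x0 : t * (m - x) = 0 by lra.
have {}y0 : (1 - t) * (m - y) = 0 by lra.
move/eqP: x0; rewrite mulf_eq0 (gt_eqF t0) /= subr_eq0 => /eqP.
move/eqP: y0; rewrite mulf_eq0 (gt_eqF t1') /= subr_eq0 => /eqP.
by split.
Qed.

(** * The oscillation ball: convexity, symmetry, dimension *)

Section OscillationBall.
Variables (R : realType) (n : nat).
Implicit Types (h c x : 'rV[R]_n) (r t : R).

Definition ext0 h (i : 'I_n.+1) : R :=
  if unlift ord0 i is Some j then h 0 j else 0.

Lemma ext0_lift h j : ext0 h (lift ord0 j) = h 0 j.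
Proof. by rewrite /ext0 liftK. Qed.

Lemma ext0_ord0 h : ext0 h ord0 = 0.
Proof. by rewrite /ext0 unlift_none. Qed.

Lemma ext0D h k i : ext0 (h + k) i = ext0 h i + ext0 k i.
Proof. by rewrite /ext0; case: unlift => [j|]; rewrite ?mxE ?addr0. Qed.

Lemma ext0Z t h i : ext0 (t *: h) i = t * ext0 h i.
Proof. by rewrite /ext0; case: unlift => [j|]; rewrite ?mxE ?mulr0. Qed.

Lemma ext0N h i : ext0 (- h) i = - ext0 h i.
Proof. by rewrite -scaleN1r ext0Z mulN1r. Qed.

Lemma ext0_le_sum h i : `|ext0 h i| <= \sum_j `|h 0 j|.
Proof.
rewrite /ext0; case: unlift => [j|]; last by rewrite normr0 sumr_ge0.
by rewrite (bigD1 j)//= lerDl sumr_ge0.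
Qed.

Definition osc_ball c r : set 'rV[R]_n :=
  [set x | forall i j, ext0 (x - c) i - ext0 (x - c) j <= r].

Lemma osc_ball_addP c r h :
  osc_ball c r (c + h) <-> forall i j, ext0 h i - ext0 h j <= r.
Proof. by rewrite /osc_ball /= addrC addKr. Qed.

Lemma convex_osc_ball c r :
  convex_set (osc_ball c r : set (convex_lmodType 'rV[R]_n)).
Proof.
apply/convex_setE => x y t t0 t1 cx cy i j.
have -> : t *: x + (1 - t) *: y - c = t *: (x - c) + (1 - t) *: (y - c).
  by apply/rowP => k; rewrite !mxE; ring.
rewrite !ext0D !ext0Z.
have := cx i j; have := cy i j; nra.
Qed.

Lemma osc_ball_centred c r : centred_at (osc_ball c r) c.
Proof.
move=> h; rewrite !osc_ball_addP; split=> hr i j; have := hr j i;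
  rewrite !ext0N; lra.
Qed.

Lemma osc_ball_absorbing c r h : 0 < r ->
  exists2 t, t != 0 & osc_ball c r (c + t *: h).
Proof.
move=> r0; set s := \sum_j `|h 0 j|.
have s0 : 0 <= s by exact: sumr_ge0.
have d0 : 0 < 2 * (1 + s) by lra.
(* Two extended coordinates of [h] differ by at most [2 * s]; the added 1 keeps the denominator
   positive when [h] is 0. *)
exists (r / (2 * (1 + s))); first by rewrite mulf_neq0 ?invr_neq0 ?gt_eqF.
apply/osc_ball_addP => i j; rewrite !ext0Z -mulrBr mulrAC ler_pdivrMr//.
rewrite ler_pM2l//.
have := ext0_le_sum h i; have := ext0_le_sum h j.
rewrite -/s !ler_norml; lra.
Qed.

(** Every [x] is on a line through [c] and another point [c + t *: (x - c)] of the ball (or is [c]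
    itself), so the affine hull is the whole space. *)
Lemma osc_ball_dimension c r : 0 < r -> has_dimension (osc_ball c r) n.
Proof.
move=> r0; exists c, fullv; split; first by rewrite dimvf dim_matrix mul1r.
have -> : [set c + w | w in [set` fullv]] = [set: 'rV[R]_n].
  by apply/seteqP; split=> // x _; exists (x - c); rewrite /= ?memvf// addrC subrK.
apply/seteqP; split=> // x _ A [affA CA].
have [t t0 ht] := osc_ball_absorbing c (x - c) r0.
have -> : x = t^-1 *: (c + t *: (x - c)) + (1 - t^-1) *: c.
  apply/rowP => k; rewrite !mxE; field.
  exact: t0.
apply: affA; apply: CA => //.
rewrite -[X in osc_ball _ _ X]addr0 -[X in _ + X](scale0r c).
by apply/osc_ball_addP => i j; rewrite !ext0Z !mul0r subrr ltW.
Qed.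

(** * The ball as the hull of finitely many candidates *)

(** The boolean is the sign, [true] for plus. The empty set is allowed and gives the centre [c]
    under both signs. *)
Definition sgn_vertex c r (p : bool * {set 'I_n}) : 'rV[R]_n :=
  if p.1 then vplus c r p.2 else vminus c r p.2.

Lemma sum_delta_mx (I : {set 'I_n}) j :
  (\sum_(i in I) delta_mx 0 i : 'rV[R]_n) 0 j = (j \in I)%:R.
Proof.
rewrite summxE; have [jI|jI] := boolP (j \in I).
  rewrite (bigD1 j)//= mxE !eqxx big1 ?addr0// => i /andP[_ ij].
  by rewrite mxE eq_sym (negPf ij) andbF.
rewrite big1// => i iI; rewrite mxE; case: eqP => //= _.
by case: eqP => // ji; rewrite ji iI in jI.
Qed.

Lemma sgn_vertexE c r p j :
  sgn_vertex c r p 0 j = c 0 j + (-1) ^+ (~~ p.1) * r * (j \in p.2)%:R.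
Proof.
by rewrite /sgn_vertex /vplus /vminus; case: p => -[] I /=;
  rewrite !mxE -?mulNr sum_delta_mx ?expr0 ?mul1r ?expr1 ?mulN1r ?mulNr.
Qed.

Lemma osc_ball_sgn_vertex c r p : 0 < r -> osc_ball c r (sgn_vertex c r p).
Proof.
move=> r0 i j.
(* All extended coordinates are 0 or one common value, [r] or [- r], so no difference exceeds
   [r]. *)
have E k : exists b : bool,
    ext0 (sgn_vertex c r p - c) k = (-1) ^+ (~~ p.1) * r * b%:R.
  rewrite /ext0; case: unlift => [l|]; last by exists false; rewrite mulr0.
  by exists (l \in p.2); rewrite !mxE sgn_vertexE addrC addKr.
have [[] ->] := E i; have [[] ->] := E j; case: p.1; rewrite /= ?expr0 ?expr1; lra.
Qed.

Definition cube_map c (y : 'I_n.+1 -> R) : 'rV[R]_n :=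
  c + \row_j (y (lift ord0 j) - y ord0).

Lemma cube_map_vertex c r y : 0 < r -> (forall i, y i = 0 \/ y i = r) ->
  exists p, cube_map c y = sgn_vertex c r p.
Proof.
move=> r0 yr; have r_neq0 : r == 0 = false by rewrite gt_eqF.
have [y0|y0] := yr ord0.
  exists (true, [set j | y (lift ord0 j) == r]%SET); apply/rowP => j.
  rewrite sgn_vertexE !mxE inE /= y0; have [->|->] := yr (lift ord0 j).
    by rewrite eq_sym r_neq0 expr0 !mulr0 subrr.
  by rewrite eqxx mulr1; ring.
exists (false, [set j | y (lift ord0 j) == 0]%SET); apply/rowP => j.
rewrite sgn_vertexE !mxE inE /= y0; have [->|->] := yr (lift ord0 j).
  by rewrite eqxx mulr1; ring.
by rewrite r_neq0 mulr0 subrr.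
Qed.

(* Induction on the list of coordinates not known to be 0 or r: y is on the
   segment joining the two points obtained by moving one of them to 0 and r. *)
Lemma cube_map_hull c r (y : 'I_n.+1 -> R) : 0 < r -> (forall i, 0 <= y i <= r) ->
  convex_hull (range (sgn_vertex c r)) (cube_map c y).
Proof.
move=> r0 cube_y.
have : forall i, i \notin enum 'I_n.+1 -> y i = 0 \/ y i = r.
  by move=> i; rewrite mem_enum.
elim: (enum _) y cube_y => [|a s IHs] y cube_y ys.
  have [p ->] := @cube_map_vertex c r y r0 (fun i => ys i isT).
  by apply: sub_gen_smallest; exists p.
pose move_to (z : R) (i : 'I_n.+1) : R := if i == a then z else y i.
have move_hull z : z = 0 \/ z = r ->
    convex_hull (range (sgn_vertex c r)) (cube_map c (move_to z)).
  move=> zr; apply: IHs => i; rewrite /move_to; case: eqP => // ia.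
    by case: zr => ->; rewrite lexx ltW.
  by move=> si; apply: ys; rewrite inE negb_or si andbT; apply/eqP.
have -> : cube_map c y =
    (y a / r) *: cube_map c (move_to r) + (1 - y a / r) *: cube_map c (move_to 0).
  have E i : y i = (y a / r) * move_to r i + (1 - y a / r) * move_to 0 i.
    rewrite /move_to; case: eqP => [->|_]; last by ring.
    by field; rewrite gt_eqF.
  apply/rowP => j; rewrite !mxE.
  rewrite [in LHS](E (lift ord0 j)) [in LHS](E ord0).
  by move: (y a / r) => t; ring.
have /andP[ya0 yar] := cube_y a.
move/convex_setE: (@convex_convex_hull R n (range (sgn_vertex c r))); apply.
- by rewrite divr_ge0 // ltW.
- by rewrite ler_pdivrMr// mul1r.
- by apply: move_hull; right.
- by apply: move_hull; left.
Qed.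

Lemma osc_ball_hull c r : 0 < r ->
  osc_ball c r = convex_hull (range (sgn_vertex c r)).
Proof.
move=> r0; apply/seteqP; split=> [x Cx|]; last first.
  apply: smallest_sub; first exact: convex_osc_ball.
  by move=> _ [p _ <-]; exact: osc_ball_sgn_vertex.
(* [cube_map] ignores a constant added to all coordinates; subtracting the least one moves them into
   [[0, r]]. *)
have [b _ b_min] := @arg_minP _ _ _ ord0 xpredT (ext0 (x - c)) isT.
have -> : x = cube_map c (fun i => ext0 (x - c) i - ext0 (x - c) b).
  by apply/rowP => j; rewrite !mxE ext0_lift ext0_ord0 !mxE; ring.
by apply: cube_map_hull => // i; rewrite subr_ge0 b_min//= Cx.
Qed.

Lemma convex_polytope_osc_ball c r : 0 < r -> convex_polytope (osc_ball c r).
Proof.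
move=> r0; exists (range (sgn_vertex c r)); last exact: osc_ball_hull.
exact/finite_image/finite_finset.
Qed.

(** * Extreme points of the ball *)

(** The reflection sending [x] to [c + (c - x)] preserves [C] and convex combinations. It carries
    the result for [vplus] over to [vminus]. *)
Lemma vertices_centred (C : set 'rV[R]_n) c h : centred_at C c ->
  vertices C (c + h) -> vertices C (c - h).
Proof.
move=> Cc [Ch ext_h]; split; first exact: (Cc h).1.
have refl x : C x -> C (c + (c - x)).
  by move=> Cx; apply: (Cc (c - x)).2; rewrite opprB addrC subrK.
move=> x y t Cx Cy t0 t1 e.
have [||//|//||ex ey] := ext_h (c + (c - x)) (c + (c - y)) t.
- exact: refl.
- exact: refl.
- apply/rowP => k; have /rowP/(_ k) := e; rewrite !mxE; lra.
- split; apply/rowP => k.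
    have /rowP/(_ k) := ex; rewrite !mxE; lra.
  have /rowP/(_ k) := ey; rewrite !mxE; lra.
Qed.

Lemma vertices_vplus c r (I : {set 'I_n}) : 0 < r -> I != finset.set0 ->
  vertices (osc_ball c r) (vplus c r I).
Proof.
move=> r0 /set0Pn[i iI]; split; first exact: (osc_ball_sgn_vertex c (true, I)).
have E x : osc_ball c r x -> forall k l, x 0 k - c 0 k <= r /\
    (x 0 k - c 0 k) - (x 0 l - c 0 l) <= r.
  move=> Cx k l; have := Cx (lift ord0 k) ord0.
  have := Cx (lift ord0 k) (lift ord0 l).
  by rewrite ext0_ord0 !ext0_lift !mxE subr0.
move=> x y t Cx Cy t0 t1 e.
have V k : t * x 0 k + (1 - t) * y 0 k = c 0 k + r * (k \in I)%:R.
  by have /rowP/(_ k) := e; rewrite !mxE sum_delta_mx.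
(* On [I] the combination attains the upper bound [c 0 k + r] valid on the whole ball. *)
have onI k : k \in I -> x 0 k = c 0 k + r /\ y 0 k = c 0 k + r.
  move=> kI; have := V k; rewrite kI mulr1.
  have [xr _] := E _ Cx k k; have [yr _] := E _ Cy k k => e'.
  by apply: (conv_eq_ub t0 t1); lra.
(* Coordinate [i] is already at its maximum, so the constraint on the pair [i], [k] bounds
   coordinate [k] below by [c 0 k]; negation turns this into an upper bound. *)
have offI k : k \notin I -> x 0 k = c 0 k /\ y 0 k = c 0 k.
  move=> kI; have := V k; rewrite (negPf kI) mulr0 addr0.
  have [_ +] := E _ Cx i k; have [_ +] := E _ Cy i k.
  have [-> ->] := onI _ iI => yi xi e'.
  by have [|||||] := @conv_eq_ub R (- x 0 k) (- y 0 k) (- c 0 k) t; lra.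
have vk k : vplus c r I 0 k = c 0 k + r * (k \in I)%:R.
  by rewrite !mxE sum_delta_mx.
split; apply/rowP => k; rewrite vk; have [kI|kI] := boolP (k \in I);
  rewrite ?mulr1 ?mulr0 ?addr0.
- by case: (onI _ kI).
- by case: (offI _ kI).
- by case: (onI _ kI).
- by case: (offI _ kI).
Qed.

Lemma vertices_vminus c r (I : {set 'I_n}) : 0 < r -> I != finset.set0 ->
  vertices (osc_ball c r) (vminus c r I).
Proof.
by move=> r0 I0; apply: vertices_centred (osc_ball_centred c r) _;
  exact: vertices_vplus.
Qed.

Lemma vertices_centre c r : (1 <= n)%N -> 0 < r -> ~ vertices (osc_ball c r) c.
Proof.
move=> n1 r0 [_ ext_c].
(* The centre is the midpoint of two opposite candidates, distinct since [n] is positive. *)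
have [|||||] := ext_c (vplus c r [set: 'I_n]) (vminus c r [set: 'I_n]) 2^-1.
- exact: (osc_ball_sgn_vertex c (true, _)).
- exact: (osc_ball_sgn_vertex c (false, _)).
- by rewrite invr_gt0.
- by rewrite invf_lt1// ltr1n.
- by apply/rowP => k; rewrite !mxE sum_delta_mx; field.
- by move=> /rowP/(_ (Ordinal n1)) + _; rewrite !mxE sum_delta_mx inE mulr1; lra.
Qed.

Lemma vertices_osc_ball c r : (1 <= n)%N -> 0 < r ->
  vertices (osc_ball c r) =
  sgn_vertex c r @` [set p | p \in [set p : bool * {set 'I_n} | p.2 != finset.set0]%SET].
Proof.
move=> n1 r0; apply/seteqP; split=> [v ext_v|_ [[b I] /= + <-]]; last first.
  by rewrite inE /sgn_vertex; case: b; [exact: vertices_vplus | exact: vertices_vminus].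
have := ext_v; rewrite osc_ball_hull// => /vertices_convex_hull[p _ pv].
exists p => //=; rewrite inE; apply/eqP => p0.
apply: (@vertices_centre c r n1 r0); rewrite -[c in vertices _ c](_ : v = c)//.
by apply/rowP => j; rewrite -pv sgn_vertexE p0 inE mulr0 addr0.
Qed.

(** * Number of vertices, and boundary points *)

Lemma sgn_vertex_inj c r : 0 < r ->
  {in [set p | p \in [set p : bool * {set 'I_n} | p.2 != finset.set0]%SET] &,
   injective (sgn_vertex c r)}.
Proof.
move=> r0 [b I] [b' I'] /=; rewrite !inE /= !inE /= => /set0Pn[i iI] _ /rowP e.
have {}e j : (-1) ^+ (~~ b) * (j \in I)%:R = (-1) ^+ (~~ b') * (j \in I')%:R :> R.
  have := e j; rewrite !sgn_vertexE /= => /addrI.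
  by rewrite ![_ * r]mulrC -!mulrA; apply: mulfI; rewrite gt_eqF.
(* At [i] in [I] the left side is 1 or -1; with the other sign the right side would be 0 or its
   opposite. *)
have bb' : b = b'.
  have := e i; rewrite iI; case: b b' (i \in I') {e} => [] [] [] //=;
  rewrite ?expr0 ?expr1; lra.
congr (_, _) => //; apply/setP => j; have := e j; rewrite bb' => /(mulfI _).
rewrite signr_eq0 => /(_ isT)/eqP; rewrite eqr_nat.
by case: (j \in I) (j \in I') => [] [].
Qed.

Lemma card_sgn_vertices :
  #|[set p : bool * {set 'I_n} | p.2 != finset.set0]%SET| = (2 * (2 ^ n - 1))%N.
Proof.
have -> : [set p : bool * {set 'I_n} | p.2 != finset.set0]%SET =
    finset.setX [set: bool] [set~ finset.set0].
  by apply/setP => p; rewrite !inE.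
rewrite cardsX cardsT card_bool cardsC1.
by rewrite -[#|{set _}|]cardsT -powersetT card_powerset cardsT card_ord subn1.
Qed.

Lemma card_vertices_osc_ball c r : (1 <= n)%N -> 0 < r ->
  vertices (osc_ball c r) #= `I_(2 * (2 ^ n - 1)).
Proof.
move=> n1 r0; rewrite vertices_osc_ball// -card_sgn_vertices.
apply: (card_eq_trans (inj_card_eq (@sgn_vertex_inj c r r0))).
exact: card_eq_finpred.
Qed.

(* A point at oscillation distance exactly r is pushed out of the ball by any
   dilation of ratio greater than 1. *)
Lemma boundary_osc_ball c r h (a b : 'I_n.+1) : 0 < r ->
  osc_ball c r (c + h) -> ext0 h a - ext0 h b = r ->
  boundary (osc_ball c r) (c + h).
Proof.
move=> r0 Ch hab; split; first exact: subset_closure.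
rewrite /interior => /nbhs_ballP[e /= e0 be].
set s := \sum_j `|h 0 j|; have s0 : 0 <= s by exact: sumr_ge0.
(* Dilating by [1 + e / (1 + s)] moves each coordinate by at most [e * s / (1 + s)], hence by less
   than [e]. *)
have d0 : 0 < e / (1 + s) by rewrite divr_gt0//; lra.
have /be/osc_ball_addP/(_ a b) : ball (c + h) e (c + (1 + e / (1 + s)) *: h).
  split=> // i j; rewrite (ord1 i) /ball/= !mxE.
  rewrite (_ : _ - _ = - (e / (1 + s) * h 0 j)); last by ring.
  rewrite normrN normrM gtr0_norm// mulrAC ltr_pdivrMr; last by lra.
  rewrite ltr_pM2l//.
  have := ext0_le_sum h (lift ord0 j); rewrite ext0_lift -/s; lra.
rewrite !ext0Z -mulrBr hab; nra.
Qed.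

End OscillationBall.

(** * The Hilbert metric in natural parameters *)

(** The subtracted term does not depend on [i], so differences of extended coordinates are
    differences of log-ratios. *)
Lemma ext0_theta0B (R : realType) (n : nat) (mu nu : 'rV[R]_n.+1) i :
  (forall i, 0 < mu 0 i) -> (forall i, 0 < nu 0 i) ->
  ext0 (theta0 mu - theta0 nu) i =
  ln (mu 0 i / nu 0 i) - ln (mu 0 ord0 / nu 0 ord0).
Proof.
move=> mu0 nu0; rewrite /ext0; case: unliftP => [j ->|->]; last by rewrite subrr.
rewrite !mxE !ln_div ?posrE//; ring.
Qed.

(** Supplies the pair of indices at which the oscillation equals the Hilbert distance, as
    [boundary_osc_ball] requires. *)
Lemma hilbert_attained (R : realType) (n : nat) (mu nu : 'rV[R]_n.+1) :
  (forall i, 0 < mu 0 i) -> (forall i, 0 < nu 0 i) ->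
  exists a b, hilbert mu nu = ln (mu 0 a / nu 0 a) - ln (mu 0 b / nu 0 b) /\
    forall i, mu 0 b / nu 0 b <= mu 0 i / nu 0 i <= mu 0 a / nu 0 a.
Proof.
move=> mu0 nu0; pose rho i := mu 0 i / nu 0 i.
have rho0 i : 0 < rho i by rewrite divr_gt0.
have [a _ a_max] := @arg_maxP _ _ _ ord0 xpredT rho isT.
have [b _ b_min] := @arg_minP _ _ _ ord0 xpredT rho isT.
exists a, b; split; last by move=> i; apply/andP; split; [exact: b_min | exact: a_max].
rewrite -ln_div ?posrE ?rho0// /hilbert; congr (ln (_ / _)).
  apply/le_anti/andP; split; last exact: le_bigmax.
  by apply/bigmax_leP; split=> [|i _]; exact: a_max.
apply/le_anti/andP; split; first exact: bigmin_le.
by apply/bigmin_geP; split=> [|i _]; exact: b_min.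
Qed.

Theorem lemma4p3 (R : realType) (n : nat) (n_ge1 : (1 <= n)%N)
    (mu nu : 'rV[R]_n.+1)
    (mu_int : simplex_interior mu) (nu_int : simplex_interior nu)
    (r : R) (r_gt0 : 0 < r) (Hr : hilbert mu nu = r) :
  exists C : set 'rV[R]_n,
    [/\ convex_polytope C,
        has_dimension C n,
        centred_at C (theta0 nu),
        vertices C =
          [set vplus (theta0 nu) r I | I in [set I : {set 'I_n} | I != finset.set0]]
          `|` [set vminus (theta0 nu) r I | I in [set I : {set 'I_n} | I != finset.set0]]
          /\ vertices C #= `I_(2 * (2 ^ n - 1))
      & boundary C (theta0 mu)].
Proof.
have [_ mu0] := mu_int; have [_ nu0] := nu_int.
exists (osc_ball (theta0 nu) r); split.
- exact: convex_polytope_osc_ball.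
- exact: osc_ball_dimension.
- exact: osc_ball_centred.
- split; last exact: card_vertices_osc_ball.
  rewrite vertices_osc_ball//; apply/seteqP; split.
    move=> _ [[[] I] /= + <-]; rewrite inE /= => I0; [left|right]; by exists I.
  by move=> _ [] [I /= I0 <-]; [exists (true, I) | exists (false, I)]; rewrite //= inE.
- have [a [b [rE ab]]] := hilbert_attained mu0 nu0.
  have lnE i := ext0_theta0B i mu0 nu0.
  rewrite -[theta0 mu](subrK (theta0 nu)) addrC.
  apply: (@boundary_osc_ball _ _ _ _ _ a b) => //; last first.
    by rewrite !lnE -Hr rE; ring.
  apply/osc_ball_addP => i j; rewrite !lnE -Hr rE.
  have le_ln k l : mu 0 k / nu 0 k <= mu 0 l / nu 0 l ->
      ln (mu 0 k / nu 0 k) <= ln (mu 0 l / nu 0 l).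
    by rewrite ler_ln// posrE divr_gt0.
  have /andP[_ /le_ln ia] := ab i; have /andP[/le_ln bj _] := ab j; lra.
Qed.
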